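(* Let $R$ be a commutative noetherian ring, let $I,\mathfrak{a}\subset R$ be ideals of positive height, and let $t\in\mathbb{R}_{>0}$. Let $\mathcal{RV}(I)$ be the set of Rees valuations of $I$. An element $x\in R$ is in $\overline{I}^{\mathfrak{a}^t}$ if and only if $\nu(x)\ge\nu(I)-t\,\nu(\mathfrak{a})$ for all $\nu\in\mathcal{RV}(I)$.
   Context: All rings are commutative with unit and noetherian. $R^\circ$ is the set of elements of $R$ not in any minimal prime of $R$. An ideal has positive height if it is not contained in any minimal prime. For ideals $I,\mathfrak{a}\subset R$ and $t\in\mathbb{R}_{>0}$ the (Hara-Yoshida) $\mathfrak{a}^t$-integral closure is $$\overline{I}^{\mathfrak{a}^t}=\{x\in R\mid \text{for some } c\in R^\circ \text{ and all } n\gg 0,\ cx^n\mathfrak{a}^{\lceil tn\rceil}\subset I^n\}.$$ $\mathcal{RV}(I)$ denotes the usual (finite) set of Rees valuations of $I$: each $\nu\in\mathcal{RV}(I)$ is the integer-valued discrete valuation of a rank one discrete valuation ring lying between $R/P$ and its fraction field for some minimal prime $P$ of $R$, regarded as a function on $R$ with value $\infty$ exactly on $P$; thus $\nu:R\setminus\{0\}\to\mathbb{Z}_{\ge0}\cup\{\infty\}$ satisfies $\nu(xy)=\nu(x)+\nu(y)$ and $\nu(x+y)\ge\min\{\nu(x),\nu(y)\}$. The set has the property that for all $n$ and $x\in R$, $x\in\overline{I^n}$ (integral closure) if and only if $\nu(x)\ge n\nu(I)$ for all $\nu\in\mathcal{RV}(I)$, and it is the minimal set with this property. For an ideal $J$,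 $\nu(J)=\min\{\nu(x)\mid x\in J\}$. *)

(* Defs.v *)
From HB Require Import structures.
From mathcomp Require Import all_boot all_order all_algebra.
From mathcomp Require Import all_classical all_reals.

Set Implicit Arguments.
Unset Strict Implicit.
Unset Printing Implicit Defensive.

Import Order.TTheory GRing.Theory Num.Theory.

Local Open Scope classical_set_scope.
Local Open Scope ring_scope.

Section Ideals.
Variable A : comPzRingType.
Implicit Types (I J P Q : set A) (x c : A) (n : nat).

(* ring_quotient's [idealr_closed] cannot be used: it forces ideals to be
   proper and decidable. *)
Definition is_ideal I : Prop :=
  [/\ I 0, forall x y, I x -> I y -> I (x + y) & forall a x, I x -> I (a * x)].

Definition ideal_gen (G : set A) : set A := smallest is_ideal G.

Definition ideal_mul I J : set A := ideal_gen [set x * y | x in I & y in J].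

Fixpoint ideal_pow I n : set A :=
  if n is m.+1 then ideal_mul I (ideal_pow I m) else [set: A].

Definition noetherian : Prop :=
  forall I, is_ideal I -> exists s : seq A, I = ideal_gen [set` s].

Definition prime_ideal P : Prop :=
  [/\ is_ideal P, ~ P 1 & forall x y, P (x * y) -> P x \/ P y].

Definition minimal_prime P : Prop :=
  prime_ideal P /\ forall Q, prime_ideal Q -> Q `<=` P -> Q = P.

(* R° *)
Definition ring_circ : set A := [set c | forall P, minimal_prime P -> ~ P c].

Definition positive_height I : Prop :=
  forall P, minimal_prime P -> ~ (I `<=` P).

Definition integral_closure I : set A :=
  [set x | exists (n : nat) (a : nat -> A),
     [/\ (0 < n)%N,
         forall i, (1 <= i <= n)%N -> ideal_pow I i (a i) &
         x ^+ n + \sum_(1 <= i < n.+1) a i * x ^+ (n - i) = 0]].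

(* The absolute value only converts the ceiling from int to nat: for t > 0
   the ceiling is nonnegative. *)
Definition hy_closure (R : realType) I (a : set A) (t : R) : set A :=
  [set x | exists2 c, ring_circ c &
     exists N : nat, forall n, (N <= n)%N ->
       forall y, ideal_pow a `|Num.ceil (t * n%:R)|%N y ->
         ideal_pow I n (c * x ^+ n * y)].

End Ideals.

(* A normalized discrete valuation of a field, with value +oo exactly at 0.
   Values live in \bar int, whose element -oo has to be excluded. *)
Definition discrete_valuation (K : fieldType) (v : K -> \bar int) : Prop :=
  [/\ forall z, v z <> -oo%E /\ (v z = +oo%E <-> z = 0),
      forall z w, v (z * w) = (v z + v w)%E,
      forall z w, (Order.min (v z) (v w) <= v (z + w)%R)%E &
      forall m : int, exists z, v z = m%:E].

Definition valuation_ring (K : fieldType) (v : K -> \bar int) : set K :=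
  [set z | (0 <= v z)%E].

(* phi : A -> K exhibits K as the fraction field of A / P. *)
Definition fraction_field_mod (A : comPzRingType) (P : set A)
    (K : fieldType) (phi : {rmorphism A -> K}) : Prop :=
  (forall x, phi x = 0 <-> P x) /\
  (forall z : K, exists a b : A, phi b <> 0 /\ z = phi a / phi b).

(* nu is the valuation of a discrete valuation ring lying between A / P and
   its fraction field K, for some minimal prime P, read as a function on A. *)
Definition dvr_valuation (A : comPzRingType) (nu : A -> \bar int) : Prop :=
  exists P : set A, minimal_prime P /\
  exists (K : fieldType) (phi : {rmorphism A -> K}) (v : K -> \bar int),
    [/\ fraction_field_mod P phi,
        discrete_valuation v,
        range phi `<=` valuation_ring v &
        forall x, nu x = v (phi x)].

(* nu(J) = min {nu x | x in J}; the default value +oo of [xget] is irrelevant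
   because the minimum exists for nonempty J and nu with values in
   {0, 1, 2, ...} and +oo. *)
Definition ideal_value (A : comPzRingType) (nu : A -> \bar int) (J : set A)
    : \bar int :=
  xget +oo%E
    [set m | (exists2 x, J x & nu x = m) /\ forall x, J x -> (m <= nu x)%E].

Definition determines_closures (A : comPzRingType) (I : set A)
    (RV : set (A -> \bar int)) : Prop :=
  [/\ finite_set RV,
      forall nu, RV nu -> dvr_valuation nu &
      forall (n : nat) (x : A), integral_closure (ideal_pow I n) x <->
        forall nu, RV nu -> (n%:R%:E * ideal_value nu I <= nu x)%E].

(* RV is the set of Rees valuations of I. *)
Definition rees_valuations (A : comPzRingType) (I : set A)
    (RV : set (A -> \bar int)) : Prop :=
  determines_closures I RV /\
  forall S, determines_closures I S -> S `<=` RV -> S = RV.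

(* The inclusion of \bar int into \bar R. *)
Definition ext_int (R : realType) (m : \bar int) : \bar R :=
  er_map (fun k : int => k%:~R) m.

(* Main.v *)
Require Import Defs.
From HB Require Import structures.
From mathcomp Require Import all_boot all_order all_algebra.
From mathcomp Require Import all_classical all_reals.
From mathcomp Require Import ring lra zify.

Set Implicit Arguments.
Unset Strict Implicit.
Unset Printing Implicit Defensive.

Import Order.TTheory GRing.Theory Num.Theory.

Local Open Scope classical_set_scope.
Local Open Scope ring_scope.

(** Applying a Rees valuation [nu], centered on the minimal prime [P], to
    [c * x ^+ n * y] with [y] in the power of [a] of exponent the ceiling of
    [t * n] gives one implication: [nu c] is finite because [c] avoids [P], and
    dividing by [n] and letting [n] grow leaves [nu I - t * nu a <= nu x]
    ([hy_closure_le_val]).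

    Conversely, the inequalities and the defining property of the Rees
    valuations show that [x ^+ n] times that power of [a] lies in the integral
    closure of [I ^ n], for each [n].  This alone is not enough: in some
    noetherian rings no single [c] outside the minimal primes multiplies the
    integral closure of [I ^ n] into [I ^ n] for every [n].  What saves the
    argument is that there are finitely many Rees valuations and that their values are integers:
    finitely many inequalities that hold for [t] already hold for some rational
    [p / q <= t] ([common_rational_exponent]).  Then only the finitely many
    elements [x ^+ q * h], with [h] among the generators of [a ^ p], have to be
    integral over [I ^ q].  Their equations of integral dependence show that,
    for [b] in [I] and one exponent [N], multiplication by [b ^+ N] sends every
    monomial of degree [l] in these elements into [I ^ (q * l)]
    ([integral_monomial_mul]).  Taking [b] in [I] outside all minimal primes,
    which is possible by prime avoidance ([positive_height_ring_circ]), the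
    element [b ^+ (q + N)] is the required multiplier ([integral_hy_closure]);
    its extra factor [b ^+ q] compensates for the remainder of [n] modulo
    [q]. *)

(** * Ideals and their powers *)

Lemma ideal_opp (A : comPzRingType) (I : set A) x :
  is_ideal I -> I x -> I (- x).
Proof. by case=> _ _ IM Ix; rewrite -mulN1r; exact: IM. Qed.

Lemma ideal_sub (A : comPzRingType) (I : set A) x y :
  is_ideal I -> I x -> I y -> I (x - y).
Proof. by move=> idI Ix Iy; case: (idI) => _ ID _; apply: ID => //; exact: ideal_opp. Qed.

Lemma ideal_sum (A : comPzRingType) (I : set A) (T : Type) (r : seq T)
    (P : pred T) (f : T -> A) :
  is_ideal I -> (forall i, P i -> I (f i)) -> I (\sum_(i <- r | P i) f i).
Proof. by case=> I0 ID _ If; apply: (big_ind I). Qed.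

Lemma ideal_gen_is_ideal (A : comPzRingType) (G : set A) :
  is_ideal (ideal_gen G).
Proof.
split.
- by move=> J [[J0 _ _] _].
- move=> x y Gx Gy J [idJ GJ]; case: (idJ) => _ JD _.
  by apply: JD; [apply: Gx|apply: Gy].
- move=> a x Gx J [idJ GJ]; case: (idJ) => _ _ JM.
  by apply: JM; apply: Gx.
Qed.

Lemma ideal_gen_min (A : comPzRingType) (G J : set A) :
  is_ideal J -> G `<=` J -> ideal_gen G `<=` J.
Proof. exact: smallest_sub. Qed.

Lemma ideal_genP (A : comPzRingType) (G : set A) : G `<=` ideal_gen G.
Proof. exact: sub_gen_smallest. Qed.

Lemma ideal_mul_in (A : comPzRingType) (I J : set A) x y :
  I x -> J y -> ideal_mul I J (x * y).
Proof. by move=> Ix Jy; apply: ideal_genP; exists x => //; exists y. Qed.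

Lemma ideal_mul_min (A : comPzRingType) (I J K : set A) :
  is_ideal K -> (forall x y, I x -> J y -> K (x * y)) -> ideal_mul I J `<=` K.
Proof.
by move=> idK IJK; apply: ideal_gen_min => // _ [x Ix [y Jy <-]]; exact: IJK.
Qed.

Lemma ideal_colon (A : comPzRingType) (I : set A) c :
  is_ideal I -> is_ideal [set y | I (y * c)].
Proof.
case=> I0 ID IM; split=> /=; first by rewrite mul0r.
- by move=> x y Ix Iy; rewrite mulrDl; exact: ID.
- by move=> a x Ix; rewrite -mulrA; exact: IM.
Qed.

Lemma ideal_pow_is_ideal (A : comPzRingType) (I : set A) n :
  is_ideal (ideal_pow I n).
Proof. by case: n => [|n] //=; exact: ideal_gen_is_ideal. Qed.

Lemma ideal_powD (A : comPzRingType) (I : set A) m n x y :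
  ideal_pow I m x -> ideal_pow I n y -> ideal_pow I (m + n) (x * y).
Proof.
move=> Ix Iy; elim: m x Ix => [|m IHm] x /=.
  by move=> _; case: (ideal_pow_is_ideal I n) => _ _ IM; exact: IM.
move=> Ix; move: x Ix; apply: ideal_mul_min.
  exact/ideal_colon/ideal_gen_is_ideal.
by move=> u v Iu Iv /=; rewrite -mulrA; apply: ideal_mul_in => //; exact: IHm.
Qed.

Lemma ideal_powS_sub (A : comPzRingType) (I : set A) n :
  ideal_pow I n.+1 `<=` ideal_pow I n.
Proof.
apply: ideal_mul_min; first exact: ideal_pow_is_ideal.
by move=> x y _; case: (ideal_pow_is_ideal I n) => _ _; exact.
Qed.

Lemma ideal_pow_le (A : comPzRingType) (I : set A) m n :
  (m <= n)%N -> ideal_pow I n `<=` ideal_pow I m.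
Proof.
move/subnK <-; elim: (n - m)%N => [|d IHd] //.
by rewrite addSn => x /ideal_powS_sub/IHd.
Qed.

Lemma ideal_pow_exp (A : comPzRingType) (I : set A) n x :
  I x -> ideal_pow I n (x ^+ n).
Proof.
by move=> Ix; elim: n => [|n IHn] //; rewrite exprS; exact: ideal_mul_in.
Qed.

Lemma ideal_pow_pow (A : comPzRingType) (I : set A) m n :
  ideal_pow (ideal_pow I m) n `<=` ideal_pow I (m * n).
Proof.
elim: n => [|n IHn]; first by rewrite muln0.
rewrite mulnS; apply: ideal_mul_min; first exact: ideal_pow_is_ideal.
by move=> x y Ix /IHn; exact: ideal_powD.
Qed.

Lemma ideal_pow_addn_sub (A : comPzRingType) (I : set A) m n :
  ideal_pow I (m + n) `<=` ideal_mul (ideal_pow I m) (ideal_pow I n).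
Proof.
elim: m => [|m IHm] /=.
  by move=> x Ix; rewrite -[x]mul1r; exact: ideal_mul_in.
apply: ideal_mul_min; first exact: ideal_gen_is_ideal.
move=> u v Iu /IHm Iv; rewrite mulrC; move: v Iv; apply: ideal_mul_min.
  exact/ideal_colon/ideal_gen_is_ideal.
move=> v w Iv Iw /=; rewrite mulrC mulrA.
by apply: ideal_mul_in => //; exact: ideal_mul_in.
Qed.

Lemma ideal_pow_muln_sub (A : comPzRingType) (I : set A) m n :
  ideal_pow I (m * n) `<=` ideal_pow (ideal_pow I m) n.
Proof.
elim: n => [|n IHn] //; rewrite mulnS => x /ideal_pow_addn_sub.
move: x; apply: ideal_mul_min; first exact: ideal_gen_is_ideal.
by move=> x y Ix /IHn; exact: ideal_mul_in.
Qed.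

(** The factor [c] makes the induction on the degree go through: it absorbs the
    factors of [y] already replaced by generators. *)
Lemma ideal_pow_gen (A : comPzRingType) (s : seq A) (K : set A) l y c :
  is_ideal K -> ideal_pow (ideal_gen [set` s]) l y ->
  (forall w : seq A, size w = l -> {subset w <= s} -> K ((\prod_(h <- w) h) * c)) ->
  K (y * c).
Proof.
move=> idK; elim: l y c => [|l IHl] y c.
  move=> _ Kw; have := Kw [::] erefl; rewrite big_nil mul1r => Kc.
  by case: idK => _ _; apply; apply: Kc.
move=> sy Kw; move: y sy; apply: ideal_mul_min; first exact: ideal_colon.
move=> u v su sv /=; rewrite -mulrA; move: u su.
apply: ideal_gen_min; first exact: ideal_colon.
move=> h sh /=; rewrite mulrCA; apply: IHl => // w sw ws.
rewrite mulrCA mulrA; have := Kw (h :: w); rewrite big_cons; apply.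
  by rewrite /= sw.
by move=> z; rewrite inE => /predU1P[->|/ws].
Qed.

(** * Minimal primes of a noetherian ring *)

(** By the induction step each counterexample lies strictly inside another one.
    Choosing such a larger one repeatedly gives a strictly increasing chain,
    whose union is finitely generated and so equals one of its terms. *)
Lemma noetherian_ind (A : comPzRingType) (F : set A -> Prop) :
  noetherian A ->
  (forall J, is_ideal J ->
     (forall K, is_ideal K -> J `<=` K -> ~ K `<=` J -> F K) -> F J) ->
  forall J, is_ideal J -> F J.
Proof.
move=> noethA step J0 idJ0; apply: contrapT => nFJ0.
pose bad := {J : set A | is_ideal J /\ ~ F J}.
have grow (J : bad) : exists K : bad,
    sval J `<=` sval K /\ ~ sval K `<=` sval J.
  case: J => J [idJ nFJ] /=; apply: contrapT => noK.
  apply: nFJ; apply: step => // K idK JK KJ; apply: contrapT => nFK.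
  by apply: noK; exists (exist _ K (conj idK nFK)).
have [g gP] := choice grow.
pose C n := sval (iter n g (exist _ J0 (conj idJ0 nFJ0)) : bad).
have idC n : is_ideal (C n) by rewrite /C; case: (iter _ _ _) => K [].
have CS n : C n `<=` C n.+1 by case: (gP (iter n g (exist _ J0 (conj idJ0 nFJ0)))).
have Cle m n : (m <= n)%N -> C m `<=` C n.
  move/subnK <-; elim: (n - m)%N => [|d IHd] // x /IHd.
  exact: CS.
pose U := [set x | exists n, C n x].
have idU : is_ideal U.
  split.
  - by exists 0%N; case: (idC 0%N).
  - move=> x y [m Cx] [n Cy]; exists (maxn m n).
    case: (idC (maxn m n)) => _ CD _; apply: CD.
      by apply: (Cle m) => //; rewrite leq_maxl.
    by apply: (Cle n) => //; rewrite leq_maxr.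
  - by move=> a x [n Cx]; exists n; case: (idC n) => _ _; apply.
have [s Us] := noethA _ idU.
have [n sn] : exists n, [set` s] `<=` C n.
  have : [set` s] `<=` U by rewrite Us; exact: ideal_genP.
  elim: s {Us} => [|h s IHs] sU; first by exists 0%N.
  have [|n sn] := IHs; first by move=> z sz; apply: sU; rewrite /= inE sz orbT.
  have [m Ch] : U h by apply: sU; rewrite /= mem_head.
  exists (maxn m n) => z /=; rewrite inE => /predU1P[->|sz].
    by apply: (Cle m) => //; rewrite leq_maxl.
  by apply: (Cle n); [rewrite leq_maxr|exact: sn].
case: (gP (iter n g (exist _ J0 (conj idJ0 nFJ0)))) => _; apply.
move=> x Cx; apply: (ideal_gen_min (idC n) sn); rewrite -Us.
by exists n.+1.
Qed.

Definition ideal_adjoin (A : comPzRingType) (J : set A) (x : A) : set A :=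
  ideal_gen (J `|` [set x]).

(** If [J] is proper and not prime, some product [x * y] lies in [J] while neither factor
    does, and a prime over [J] lies over [J + (x)] or over [J + (y)]. *)
Lemma finite_primes_over (A : comPzRingType) (J : set A) :
  noetherian A -> is_ideal J ->
  exists s : seq (set A), (forall P, P \in s -> prime_ideal P) /\
    forall Q, prime_ideal Q -> J `<=` Q -> exists2 P, P \in s & P `<=` Q.
Proof.
move=> noethA; move: J; apply: noetherian_ind => // J idJ IHJ.
case: (pselect (J 1)) => [J1|nJ1].
  by exists [::]; split=> // Q [_ nQ1 _] JQ; case: nQ1; exact: JQ.
case: (pselect (prime_ideal J)) => [prJ|nprJ].
  exists [:: J]; split=> [P|Q _ JQ]; first by rewrite inE => /eqP->.
  by exists J => //; rewrite mem_head.
have [x [y [Jxy nJx nJy]]] : exists x y, [/\ J (x * y), ~ J x & ~ J y].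
  apply: contrapT => noxy; apply: nprJ; split=> // x y Jxy.
  apply: contrapT => /not_orP[nJx nJy]; apply: noxy; by exists x, y.
have adj z : ~ J z -> exists s : seq (set A),
    (forall P, P \in s -> prime_ideal P) /\
    forall Q, prime_ideal Q -> J `<=` Q -> Q z -> exists2 P, P \in s & P `<=` Q.
  move=> nJz; have Jz : J `<=` ideal_adjoin J z.
    by move=> u Ju; apply: ideal_genP; left.
  have [||s [sP sQ]] := IHJ (ideal_adjoin J z) _ Jz.
  - exact: ideal_gen_is_ideal.
  - by move=> JzJ; apply: nJz; apply: JzJ; apply: ideal_genP; right.
  exists s; split=> // Q prQ JQ Qz; apply: sQ => //; apply: ideal_gen_min.
    by case: prQ.
  by move=> u [/JQ|->].
have [s1 [s1P s1Q]] := adj x nJx; have [s2 [s2P s2Q]] := adj y nJy.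
exists (s1 ++ s2); split=> [P|Q prQ JQ].
  by rewrite mem_cat => /orP[/s1P|/s2P].
case: (prQ) => _ _ /(_ x y (JQ _ Jxy)) [Qx|Qy].
  by have [P sP PQ] := s1Q Q prQ JQ Qx; exists P => //; rewrite mem_cat sP.
by have [P sP PQ] := s2Q Q prQ JQ Qy; exists P => //; rewrite mem_cat sP orbT.
Qed.

(** A minimal prime contains a member of the finite list of primes obtained
    over the zero ideal, hence equals it. *)
Lemma finite_minimal_primes (A : comPzRingType) :
  noetherian A ->
  exists s : seq (set A), forall P, P \in s <-> minimal_prime P.
Proof.
move=> noethA.
have id0 : is_ideal [set (0 : A)].
  by split=> // [x y -> ->|c x ->] /=; rewrite ?addr0 ?mulr0.
have [s [sP sQ]] := finite_primes_over noethA id0.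
exists [seq P <- s | `[< minimal_prime P >]] => P; rewrite mem_filter.
split=> [/andP[/asboolP]|minP] //; apply/andP; split; first exact/asboolP.
case: (minP) => prP minP'.
have [|Q sQ' QP] := sQ P prP; first by move=> x ->; case: prP => -[].
by rewrite -(minP' Q) //; exact: sP.
Qed.

(** Multiply together one element of [Q] outside [P] for each [Q]. *)
Lemma prime_avoid_common (A : comPzRingType) (P : set A) (s : seq (set A)) :
  prime_ideal P -> (forall Q, Q \in s -> is_ideal Q /\ ~ Q `<=` P) ->
  exists2 e, forall Q, Q \in s -> Q e & ~ P e.
Proof.
move=> prP; case: (prP) => _ nP1 PM.
elim: s => [|Q s IHs] sQ; first by exists 1.
have [|e se nPe] := IHs; first by move=> K sK; apply: sQ; rewrite inE sK orbT.
have [[_ _ QM] /nonsubset[u [Qu nPu]]] := sQ Q (mem_head _ _).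
exists (e * u); last by case/PM.
move=> K; rewrite inE => /predU1P[->|sK]; first exact: QM.
rewrite mulrC; have [|[_ _ KM] _] := sQ K; first by rewrite inE sK orbT.
by apply: KM; exact: se.
Qed.

(** Prime avoidance.  When the element [b] found for the first primes falls
    into the next one [P], it is corrected by an element of [I] outside [P]
    that lies in all the earlier primes; such an element exists because
    distinct minimal primes are incomparable. *)
Lemma positive_height_ring_circ (A : comPzRingType) (I : set A) :
  noetherian A -> is_ideal I -> positive_height I ->
  exists2 b, I b & ring_circ b.
Proof.
move=> noethA idI htI; have [s sP] := finite_minimal_primes noethA.
suff [b Ib sb] : exists2 b, I b & forall P, P \in s -> ~ P b.
  by exists b => // P /sP; exact: sb.
case: (idI) => I0 ID IM.
have {sP} : forall P, P \in s -> minimal_prime P by move=> P /sP.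
elim: s => [|P s IHs] sP; first by exists 0.
have [|b Ib sb] := IHs; first by move=> Q sQ; apply: sP; rewrite inE sQ orbT.
case: (pselect (P b)) => [Pb|nPb]; last first.
  by exists b => // Q; rewrite inE => /predU1P[->|/sb].
have [prP minP] := sP P (mem_head _ _).
have [[_ PD _] _ PM] := prP.
have [|e se nPe] := prime_avoid_common (s := s) prP.
  move=> Q sQ; have [prQ _] : minimal_prime Q by apply: sP; rewrite inE sQ orbT.
  split; first by case: prQ.
  by move=> QP; apply: (sb Q sQ); rewrite (minP Q).
have [y [Iy nPy]] := nonsubset (htI P (sP P (mem_head _ _))).
exists (b + y * e); first by apply: ID => //; rewrite mulrC; exact: IM.
move=> Q; rewrite inE => /predU1P[->|sQ].
  move=> Pbye; have /PM[] // : P (y * e).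
  by rewrite -(addKr b (y * e)) addrC; apply: ideal_sub => //; case: prP.
have idQ : is_ideal Q.
  by have [[]] : minimal_prime Q by apply: sP; rewrite inE sQ orbT.
move=> Qbye; apply: (sb Q sQ); rewrite -(addrK (y * e) b).
by apply: ideal_sub => //; case: (idQ) => _ _; apply; exact: se.
Qed.

Lemma ring_circX (A : comPzRingType) (b : A) n : ring_circ b -> ring_circ (b ^+ n).
Proof.
move=> cb P minP; have [[_ nP1 PM] _] := minP.
elim: n => [|n IHn] //; rewrite exprS => /PM[] //; exact: cb.
Qed.

(** * Elements integral over a power of an ideal *)

(** With [z] of degree [d] over [I ^ q], the equation of integral dependence
    rewrites [z ^ m] for [m >= d] through lower powers of [z]; below [d] the
    factor [b ^ (q * d)] alone supplies the required power of [I]. *)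
Lemma integral_exp_mul (A : comPzRingType) (I : set A) q z b :
  I b -> integral_closure (ideal_pow I q) z ->
  exists N, forall m, ideal_pow I (q * m) (z ^+ m * b ^+ N).
Proof.
move=> Ib [d [a [d_gt0 aI zE]]]; exists (q * d)%N.
elim/ltn_ind => m IHm; have idm := ideal_pow_is_ideal I (q * m).
case: (ltnP m d) => [lt_md|le_dm].
  case: (idm) => _ _; apply; apply: (@ideal_pow_le _ _ _ (q * d)).
    by rewrite leq_mul2l ltnW ?orbT.
  exact: ideal_pow_exp.
have -> : z ^+ m = - \sum_(1 <= i < d.+1) a i * z ^+ (d - i) * z ^+ (m - d).
  rewrite -big_distrl /= -mulNr -(subnKC le_dm) exprD addKn; congr (_ * _).
  by apply/eqP; rewrite -addr_eq0 zE.
rewrite mulNr; apply: ideal_opp => //; rewrite mulr_suml big_nat_cond.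
apply: ideal_sum => // i; rewrite andbT ltnS => /andP[i_gt0 le_id].
have -> : a i * z ^+ (d - i) * z ^+ (m - d) * b ^+ (q * d) =
    a i * (z ^+ (m - i) * b ^+ (q * d)).
  by rewrite !mulrA -[_ * _ * z ^+ _]mulrA -exprD addnBAC // subnKC.
rewrite -(subnKC (leq_trans le_id le_dm)) mulnDr; apply: ideal_powD.
  by apply: ideal_pow_pow; apply: aI; rewrite i_gt0.
by rewrite addKn; apply: IHm; lia.
Qed.

(** One exponent [N] serves all monomials in finitely many integral elements:
    grouping equal factors turns a monomial into a product of powers, and the
    exponents from [integral_exp_mul] add up. *)
Lemma integral_monomial_mul (A : comPzRingType) (I : set A) q b (s : seq A) :
  I b -> (forall z, z \in s -> integral_closure (ideal_pow I q) z) ->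
  exists N, forall w : seq A, {subset w <= s} ->
    ideal_pow I (q * size w) ((\prod_(z <- w) z) * b ^+ N).
Proof.
move=> Ib; elim: s => [|z s IHs] sI.
  exists 0%N => -[|h w] ws; first by rewrite muln0.
  by have := ws h (mem_head _ _).
have [|N sN] := IHs; first by move=> h sh; apply: sI; rewrite inE sh orbT.
have [M zM] := integral_exp_mul Ib (sI z (mem_head _ _)).
exists (M + N)%N => w ws; rewrite (bigID (pred1 z)) /=.
rewrite (eq_bigr (fun=> z)) => [|h /eqP//].
rewrite big_const_seq iter_mulr_1 -big_filter exprD mulrACA.
rewrite -(count_predC (pred1 z) w) mulnDr; apply: ideal_powD => //.
rewrite -size_filter; apply: sN => h; rewrite mem_filter => /andP[/= hz /ws].
by rewrite inE (negPf hz).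
Qed.

(** * Valuations centered on a minimal prime *)

(** What the argument uses of the valuation of a discrete valuation ring
    between [A / P] and its fraction field, read on [A]. *)
Definition nat_valuation (A : comPzRingType) (P : set A) (nu : A -> \bar int) :=
  [/\ forall x, nu x = +oo%E <-> P x,
      forall x, nu x = +oo%E \/ exists k : nat, nu x = k%:Z%:E,
      forall x y, nu (x * y) = (nu x + nu y)%E &
      forall x y, (Order.min (nu x) (nu y) <= nu (x + y)%R)%E].

Lemma dvr_nat_valuation (A : comPzRingType) (nu : A -> \bar int) :
  dvr_valuation nu -> exists2 P, minimal_prime P & nat_valuation P nu.
Proof.
case=> P [minP [K [phi [v [[phi0 _] [vfin vM vD _] phi_ge0 nuE]]]]].
exists P => //; split.
- by move=> x; rewrite nuE -phi0; case: (vfin (phi x)).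
- move=> x; have : (0 <= nu x)%E by rewrite nuE; apply: phi_ge0; exists x.
  case: (nu x) => [r| |] //; last by left.
  by rewrite lee_fin; case: r => // k _; right; exists k.
- by move=> x y; rewrite !nuE rmorphM vM.
- by move=> x y; rewrite !nuE rmorphD; exact: vD.
Qed.

Definition val_ge (A : comPzRingType) (nu : A -> \bar int) (d : nat) : set A :=
  [set x | (d%:Z%:E <= nu x)%E].

Lemma val_ge_ideal (A : comPzRingType) (P : set A) (nu : A -> \bar int) d :
  prime_ideal P -> nat_valuation P nu -> is_ideal (val_ge nu d).
Proof.
move=> [[P0 _ _] _ _] [nuP nuN nuM nuD]; rewrite /val_ge; split=> /=.
- by rewrite (iffRL (nuP 0) P0) leey.
- move=> x y nux nuy; apply: le_trans (nuD x y).
  by rewrite le_min nux nuy.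
- move=> c x nux; rewrite nuM.
  case: (nuN c) => [->|[k ->]].
    by rewrite addye ?leey //; case: (nu x) nux.
  by case: (nu x) nux => [r| |] //; rewrite -?EFinD ?lee_fin ?leey; lia.
Qed.

Lemma val_geM (A : comPzRingType) (P : set A) (nu : A -> \bar int) d e x y :
  nat_valuation P nu -> val_ge nu d x -> val_ge nu e y ->
  val_ge nu (d + e) (x * y).
Proof.
move=> [_ _ nuM _]; rewrite /val_ge /= nuM PoszD EFinD; exact: leeD.
Qed.

Lemma val_geX (A : comPzRingType) (P : set A) (nu : A -> \bar int) d n x :
  prime_ideal P -> nat_valuation P nu ->
  val_ge nu d x -> val_ge nu (n * d) (x ^+ n).
Proof.
move=> prP nuP nux; elim: n => [|n IHn]; last first.
  by rewrite exprS mulSn; exact: (val_geM nuP).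
case: (nuP) => _ nuN _ _; rewrite mul0n /val_ge /=.
by case: (nuN (x ^+ 0)) => [->|[k ->]]; rewrite ?leey ?lee_fin.
Qed.

Lemma val_ge_ideal_pow (A : comPzRingType) (P : set A) (nu : A -> \bar int)
    (J : set A) d n :
  prime_ideal P -> nat_valuation P nu ->
  J `<=` val_ge nu d -> ideal_pow J n `<=` val_ge nu (n * d).
Proof.
move=> prP nuP Jd; elim: n => [|n IHn].
  move=> x _; case: (nuP) => _ nuN _ _; rewrite mul0n /val_ge /=.
  by case: (nuN x) => [->|[k ->]]; rewrite ?leey ?lee_fin.
apply: ideal_mul_min; first exact: (val_ge_ideal _ prP nuP).
by move=> x y /Jd nux /IHn nuy; rewrite mulSn; exact: (val_geM nuP).
Qed.

Lemma valX (A : comPzRingType) (P : set A) (nu : A -> \bar int) (k n : nat) x :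
  prime_ideal P -> nat_valuation P nu ->
  nu x = k%:Z%:E -> nu (x ^+ n) = (n * k)%N%:Z%:E.
Proof.
move=> [_ nP1 _] [nuP nuN nuM _] nux; elim: n => [|n IHn]; last first.
  by rewrite exprS nuM IHn nux mulSn PoszD EFinD.
rewrite expr0 mul0n; have := nuM 1 1; rewrite mulr1.
case: (nuN 1) => [/nuP //|[j ->]].
by rewrite -EFinD => -[jj]; congr (_%:Z%:E); lia.
Qed.

(** An element outside [P] has finite value, so the least value on [J] is a
    natural number, attained because the naturals are well ordered. *)
Lemma ideal_value_nat (A : comPzRingType) (P : set A) (nu : A -> \bar int)
    (J : set A) :
  nat_valuation P nu -> ~ J `<=` P ->
  exists d : nat, [/\ ideal_value nu J = d%:Z%:E, J `<=` val_ge nu d &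
    exists2 x, J x & nu x = d%:Z%:E].
Proof.
move=> [nuP nuN _ _] /nonsubset[x [Jx nPx]].
pose attained d := `[< exists2 y, J y & nu y = d%:Z%:E >].
have exd : exists d, attained d.
  by case: (nuN x) => [/nuP//|[d nux]]; exists d; apply/asboolP; exists x.
case: (ex_minnP exd) => d /asboolP[y Jy nuy] dmin.
have dle z : J z -> (d%:Z%:E <= nu z)%E.
  move=> Jz; case: (nuN z) => [->|[k nuz]]; first exact: leey.
  by rewrite nuz lee_fin lez_nat dmin //; apply/asboolP; exists z.
exists d; split=> //; last by exists y.
apply: xget_subset1; first by split=> //; exists y.
move=> m n [[u Ju <-] mle] [[v Jv <-] nle].
by apply/eqP; rewrite eq_le mle // nle.
Qed.

(** * The valuative criterion for the closure *)

(** An inequality [i <= k + t * a] with [k < i] bounds [t] from below by the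
    rational number [(i - k) / a], and one with [i <= k] holds for all
    nonnegative [t]; so [p / q] can be taken as the largest of these bounds. *)
Lemma common_rational_exponent (R : realType) (t : R) (T : eqType) (s : seq T)
    (i k a : T -> nat) :
  0 <= t ->
  (forall z, z \in s -> (i z)%:R <= (k z)%:R + t * (a z)%:R) ->
  exists p q : nat, [/\ (0 < q)%N, p%:R <= t * q%:R &
    forall z, z \in s -> (q * i z <= q * k z + p * a z)%N].
Proof.
move=> t_ge0; elim: s => [|z s IHs] st.
  by exists 0%N, 1%N; rewrite mulr1.
have [|p [q [q_gt0 le_pq sq]]] := IHs.
  by move=> y sy; apply: st; rewrite inE sy orbT.
have tz := st z (mem_head _ _).
case: (leqP (q * i z) (q * k z + p * a z)) => [zq|nzq].
  by exists p, q; split=> // y; rewrite inE => /predU1P[->|/sq].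
have lt_ki : (k z < i z)%N.
  by rewrite -(ltn_pmul2l q_gt0); apply: leq_ltn_trans nzq; rewrite leq_addr.
have a_gt0 : (0 < a z)%N.
  have [az0|//] := posnP (a z); move: tz.
  by rewrite az0 mulr0 addr0 ler_nat leqNgt lt_ki.
(* The inequality for [z] fails at [p / q]: pass to the smallest exponent at
   which it holds, which is then larger than [p / q]. *)
exists (i z - k z)%N, (a z); split=> //.
  by rewrite natrB 1?ltnW // lerBlDl.
have le_slope : (a z * p <= q * (i z - k z))%N.
  by rewrite mulnBr mulnC; lia.
move=> y; rewrite inE => /predU1P[->|/sq yq]; first by nia.
rewrite -(leq_pmul2l q_gt0) mulnDr.
have := leq_mul (leqnn (a z)) yq; have := leq_mul le_slope (leqnn (a y)).
nia.
Qed.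

(** Evaluate [nu] on [c * x ^+ n * y ^+ m] with [y] of minimal value in [a]:
    the contribution of [c] and the rounding of [t * n] stay bounded as [n]
    grows, so the inequality holds up to a bounded error after scaling by
    every large [n]. *)
Lemma hy_closure_le_val (R : realType) (A : comPzRingType) (I a P : set A)
    (t : R) (nu : A -> \bar int) (i al k : nat) x :
  0 < t -> minimal_prime P -> nat_valuation P nu ->
  I `<=` val_ge nu i -> (exists2 y, a y & nu y = al%:Z%:E) ->
  nu x = k%:Z%:E -> hy_closure I a t x ->
  i%:R <= k%:R + t * al%:R.
Proof.
move=> t_gt0 minP nuP Ii [y ay nuy] nux [c cc [N cN]].
have prP := minP.1; case: (nuP) => nuPE nuN nuM _.
have [j nuc] : exists j : nat, nu c = j%:Z%:E.
  by case: (nuN c) => [/nuPE/(cc _ minP)|].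
have bound n : (N <= n)%N ->
    n%:R * i%:R <= j%:R + n%:R * k%:R + (t * n%:R + 1) * al%:R :> R.
  move=> /cN cn; set m := `|Num.ceil (t * n%:R)|%N in cn.
  have := val_ge_ideal_pow prP nuP Ii (cn _ (ideal_pow_exp m ay)).
  rewrite /val_ge /= !nuM nuc (valX n prP nuP nux) (valX m prP nuP nuy).
  rewrite -!EFinD lee_fin -!PoszD lez_nat => le_nat.
  have le_m : m%:R <= t * n%:R + 1 :> R.
    have tn0 : 0 <= t * n%:R by rewrite mulr_ge0 // ltW.
    rewrite /m -[_%:R]/((Posz _)%:~R) gez0_abs ?ceil_ge0 ?(lt_le_trans _ tn0) ?ltrN10 //.
    by have := ltW (ceilB1_lt (t * n%:R)); rewrite intrD lerBlDr.
  rewrite -natrM (le_trans (y := (j + n * k + m * al)%:R)) ?ler_nat //.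
  by rewrite !natrD !natrM lerD2l ler_wpM2r.
rewrite leNgt; apply/negP => lt_i.
pose e : R := i%:R - (k%:R + t * al%:R); have e_gt0 : 0 < e by rewrite subr_gt0.
pose n := maxn N (Num.bound ((j%:R + al%:R) / e)).
have : (j%:R + al%:R) / e < n%:R.
  apply: lt_le_trans (archi_boundP _) _; last by rewrite ler_nat leq_maxr.
  by apply: divr_ge0; [exact: addr_ge0|exact: ltW].
rewrite ltr_pdivrMr // ltNge => /negP; apply.
have := bound n (leq_maxl _ _); rewrite /e; lra.
Qed.

(** With [p / q <= t], the elements [x ^+ q * h], for [h] in a finite
    generating set of [a ^ p], are integral over [I ^ q], and monomials in
    them of degree [n %/ q] generate [x ^+ (q * (n %/ q))] times a power of
    [a] containing the one for [n].  A power of an element of [I] outside the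
    minimal primes then serves as the multiplier for every [n]. *)
Lemma integral_hy_closure (R : realType) (A : comPzRingType) (I a : set A)
    (t : R) (p q : nat) x :
  noetherian A -> is_ideal I -> positive_height I ->
  (0 < q)%N -> p%:R <= t * q%:R ->
  (forall y, ideal_pow a p y -> integral_closure (ideal_pow I q) (x ^+ q * y)) ->
  hy_closure I a t x.
Proof.
move=> noethA idI htI q_gt0 le_pq intx.
have [b Ib cb] := positive_height_ring_circ noethA idI htI.
have [s as_] := noethA _ (ideal_pow_is_ideal a p).
have [|N sN] := integral_monomial_mul (s := [seq x ^+ q * h | h <- s]) (q := q) Ib.
  move=> _ /mapP[h sh ->]; apply: intx; rewrite as_; exact: ideal_genP.
exists (b ^+ (q + N)); first exact: ring_circX.
exists 0%N => n _ y; set m := `|_|%N => ay.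
set l := (n %/ q)%N; have n_eq : n = (q * l + n %% q)%N by rewrite mulnC -divn_eq.
have le_plm : (p * l <= m)%N.
  rewrite -(ler_nat R) natrM.
  have le_tn : t * n%:R <= m%:R.
    apply: le_trans (ceil_ge _) _.
    by rewrite -[m%:R]/((Posz m)%:~R) ler_int lez_abs.
  apply: le_trans le_tn.
  have t_ge0 : 0 <= t.
    by rewrite -(pmulr_lge0 _ (_ : 0 < q%:R)) ?ltr0n // (le_trans _ le_pq).
  apply: (@le_trans _ _ (t * (q * l)%:R)).
    by rewrite natrM mulrA ler_wpM2r.
  by rewrite ler_wpM2l // ler_nat [leqRHS]n_eq leq_addr.
have Iql : ideal_pow I (q * l) (y * (x ^+ (q * l) * b ^+ N)).
  apply: (@ideal_pow_gen _ s _ l _ _ (ideal_pow_is_ideal I _)).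
    by rewrite -as_; exact/ideal_pow_muln_sub/(ideal_pow_le le_plm).
  move=> w sw ws; have := sN [seq x ^+ q * h | h <- w].
  rewrite size_map sw big_map big_split /= big_const_seq count_predT sw.
  rewrite iter_mulr_1 -exprM mulrCA mulrA; apply.
  by move=> _ /mapP[h /ws sh ->]; exact: map_f.
have -> : b ^+ (q + N) * x ^+ n * y =
    x ^+ (n %% q) * (b ^+ q * (y * (x ^+ (q * l) * b ^+ N))).
  by rewrite {1}n_eq !exprD; ring.
case: (ideal_pow_is_ideal I n) => _ _; apply.
apply: (@ideal_pow_le _ _ _ (q + q * l)).
  by rewrite {1}n_eq addnC leq_add2r ltnW ?ltn_pmod.
by apply: ideal_powD => //; exact: ideal_pow_exp.
Qed.

Theorem theorem3p9 (R : realType) (A : comPzRingType) (I a : set A) (t : R)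
    (RV : set (A -> \bar int))
    (noethA : noetherian A)
    (idealI : is_ideal I) (htI : positive_height I)
    (ideala : is_ideal a) (hta : positive_height a)
    (t_gt0 : 0 < t)
    (reesRV : rees_valuations I RV)
    (x : A) :
  hy_closure I a t x <->
  forall nu, RV nu ->
    (ext_int R (ideal_value nu I) - t%:E * ext_int R (ideal_value nu a)
       <= ext_int R (nu x))%E.
Proof.
case: reesRV => -[finRV dvrRV closRV] _.
have ext_le (i al k : nat) :
    (ext_int R i%:Z%:E - t%:E * ext_int R al%:Z%:E <= ext_int R k%:Z%:E)%E =
    (i%:R <= k%:R + t * al%:R).
  by rewrite /ext_int /= -EFinD lee_fin lerBlDr.
split=> [hyx nu /dvrRV/dvr_nat_valuation[P minP nuP]|lex].
  have [i [-> Ii _]] := ideal_value_nat nuP (htI P minP).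
  have [al [-> _ ay]] := ideal_value_nat nuP (hta P minP).
  case: (nuP) => _ nuN _ _; case: (nuN x) => [->|[k nux]]; first exact: leey.
  rewrite nux ext_le.
  exact: hy_closure_le_val t_gt0 minP nuP Ii ay nux hyx.
(* If [nu x] is infinite, any natural number is a lower bound for it; the
   value of [I] makes the inequality hold. *)
have bounds nu : exists f : nat * nat * nat, RV nu ->
    [/\ ideal_value nu I = f.1.1%:Z%:E, a `<=` val_ge nu f.2,
        val_ge nu f.1.2 x & f.1.1%:R <= f.1.2%:R + t * f.2%:R].
  case: (pselect (RV nu)) => [RVnu|nRVnu]; last by exists (0, 0, 0)%N.
  have [P minP nuP] := dvr_nat_valuation (dvrRV _ RVnu).
  have := lex nu RVnu.
  have [i [-> _ _]] := ideal_value_nat nuP (htI P minP).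
  have [al [-> aal _]] := ideal_value_nat nuP (hta P minP).
  case: (nuP) => _ nuN _ _; case: (nuN x) => [nux _|[k nux]].
    exists (i, i, al) => _; split=> //=; first by rewrite /val_ge /= nux leey.
    by rewrite lerDl mulr_ge0 // ltW.
  rewrite nux ext_le => le_ik; exists (i, k, al) => _; split=> //=.
  by rewrite /val_ge /= nux.
have [f fP] := choice bounds.
have [s RVs] : exists s : seq (A -> \bar int), RV = [set` s] by exact/finite_seqP.
have [|p [q [q_gt0 le_pq sq]]] := common_rational_exponent (s := s)
    (i := fun nu => (f nu).1.1) (k := fun nu => (f nu).1.2)
    (a := fun nu => (f nu).2) (ltW t_gt0).
  by move=> nu snu; have [|] := fP nu; first by rewrite RVs.
apply: (integral_hy_closure noethA idealI htI q_gt0 le_pq) => y ay.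
apply/closRV => nu RVnu; have [-> aal kx _] := fP nu RVnu.
have [P [prP _] nuP] := dvr_nat_valuation (dvrRV _ RVnu).
have := val_geM nuP (val_geX q prP nuP kx) (val_ge_ideal_pow prP nuP aal ay).
apply: le_trans; rewrite -EFinM lee_fin -natz -natrM !natz lez_nat.
by apply: sq; rewrite RVs in RVnu.
Qed.
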